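(* Let $R$ be a commutative ring, $\sigma\in\mathrm{Aut}(R)$ with $\sigma^p=\mathrm{Id}_R$, $\omega=\{\mathfrak m_0,\sigma(\mathfrak m_0),\dots,\sigma^{p-1}(\mathfrak m_0)\}$ a $\sigma$-orbit in $\mathrm{MaxSpec}(R)$ with $p$ elements, $\Bbbk=R/\mathfrak m_0$, and $t,t'\in R$ regular elements. Suppose $B^t_\omega=B^{t'}_\omega=B^{tt'}_\omega=\emptyset$. Then for all $F\in\mathrm{Aut}_{\Bbbk}(\Bbbk^d)$ and $G\in\mathrm{Aut}_{\Bbbk}(\Bbbk^{d'})$ there is an isomorphism of $A(tt')$-modules $$V^t(\omega,1^p,F)\otimes_RV^{t'}(\omega,1^p,G)\simeq V^{tt'}(\omega,1^p,F\otimes G).$$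
   Context: $A(t)$ is the ring generated over $R$ by $X,Y$ with $Xr=\sigma(r)X$, $Yr=\sigma^{-1}(r)Y$ ($r\in R$), $YX=t$, $XY=\sigma(t)$. A weight module is an $A(t)$-module $M=\bigoplus_{\mathfrak m\in\mathrm{MaxSpec}(R)}M_{\mathfrak m}$, $M_{\mathfrak m}=\{v\mid\mathfrak mv=0\}$. For a weight $A(t)$-module $M$ and a weight $A(t')$-module $M'$, $M\otimes_RM'$ is an $A(tt')$-module via $X(v\otimes v')=Xv\otimes Xv'$, $Y(v\otimes v')=Yv\otimes Yv'$. $B^t_\omega=\{\mathfrak m\in\omega\mid t\in\mathfrak m\}$. For $B^t_\omega=\emptyset$ and $F\in\mathrm{Aut}_\Bbbk(\Bbbk^d)$ (an invertible matrix), $V^t(\omega,1^p,F)=\bigoplus_{1\le k\le p,\,1\le s\le d}(R/\sigma^k(\mathfrak m_0))e_{k,s}$ with $Xe_{k,s}=\sigma(t)e_{k+1,s}$ for $k\ne p$, $Xe_{p,s}=\sigma(t)\sigma(F)e_{1,s}$, $Ye_{k,s}=e_{k-1,s}$ for $k\neq1$, $Ye_{1,s}=F^{-1}e_{p,s}$. Here $\Bbbk^d$ is identified with $\bigoplus_s\Bbbk e_{p,s}$ (so $F^{-1}$ acts on it), and $\sigma(F)$ is the automorphism of $\bigoplus_s(R/\sigma(\mathfrak m_0))e_{1,s}$ given by the matrix obtained from $F$ by applying the isomorphism $R/\mathfrak m_0\to R/\sigma(\mathfrak m_0)$ induced by $\sigma$; $X$ and $Y$ are extended by $X(rv)=\sigma(r)Xv$,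 $Y(rv)=\sigma^{-1}(r)Yv$. *)

(* Defs.v *)
From HB Require Import structures.
From mathcomp Require Import all_boot all_order all_algebra.
From mathcomp Require Import generic_quotient ring_quotient.
From mathcomp Require Import boolp classical_sets functions cardinality.
From mathcomp Require Import freeg mxtens.

Set Implicit Arguments.
Unset Strict Implicit.
Unset Printing Implicit Defensive.

Import GRing.Theory.

Local Open Scope ring_scope.
Local Open Scope quotient_scope.

Record ringAut (R : comNzRingType) := RingAut {
  aut_fun :> {rmorphism R -> R};
  aut_inv : R -> R;
  aut_funK : cancel aut_fun aut_inv;
  aut_invK : cancel aut_inv aut_fun
}.

Section AutInv.
Variables (R : comNzRingType) (sigma : ringAut R).

Fact aut_inv_zmod : zmod_morphism (aut_inv sigma).
Proof. exact: can2_zmod_morphism (aut_funK sigma) (aut_invK sigma). Qed.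

Fact aut_inv_monoid : monoid_morphism (aut_inv sigma).
Proof. exact: can2_monoid_morphism (aut_funK sigma) (aut_invK sigma). Qed.

HB.instance Definition _ := GRing.isZmodMorphism.Build R R _ aut_inv_zmod.
HB.instance Definition _ := GRing.isMonoidMorphism.Build R R _ aut_inv_monoid.

End AutInv.

(* [idealr_closed] includes properness ([1] is not in the ideal). *)
Record maxSpec (R : comNzRingType) := MaxSpec {
  max_pred :> {pred R};
  max_ideal : idealr_closed max_pred;
  max_maximal : forall J : {pred R}, idealr_closed J ->
    {subset max_pred <= J} -> {subset J <= max_pred}
}.

Section Residue.
Variables (R : comNzRingType) (m : maxSpec R).

HB.instance Definition _ := isIdealr.Build R (max_pred m) (max_ideal m).

Definition residue : Type := {ideal_quot (max_pred m)}.

HB.instance Definition _ := GRing.ComNzRing.on residue.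
HB.instance Definition _ := Quotient.on residue.

Definition residue_pi (x : R) : residue := \pi_{ideal_quot (max_pred m)} x.
Definition residue_repr (a : residue) : R :=
  @repr _ {ideal_quot (max_pred m)} a.

Fact residue_reprK a : residue_pi (residue_repr a) = a.
Proof. exact: reprK. Qed.

Fact residue_piP x y : residue_pi x = residue_pi y <-> x - y \in m.
Proof.
rewrite /residue_pi; split=> [|h]; first by move/eqP; rewrite -Quotient.idealrBE.
by apply/eqP; rewrite -Quotient.idealrBE.
Qed.

Fact residue_repr_pi x : residue_repr (residue_pi x) - x \in m.
Proof. by apply/residue_piP; rewrite residue_reprK. Qed.

Fact residue_pi_zmod : zmod_morphism residue_pi.
Proof. exact: (@rmorphB _ _ (\pi_{ideal_quot (max_pred m)})). Qed.

Fact residue_pi_monoid : monoid_morphism residue_pi.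
Proof.
split; first exact: (@rmorph1 _ _ (\pi_{ideal_quot (max_pred m)})).
exact: (@rmorphM _ _ (\pi_{ideal_quot (max_pred m)})).
Qed.

HB.instance Definition _ :=
  GRing.isZmodMorphism.Build R residue residue_pi residue_pi_zmod.
HB.instance Definition _ :=
  GRing.isMonoidMorphism.Build R residue residue_pi residue_pi_monoid.

Fact residue_invP (a : residue) : a != 0 -> exists b : residue, b * a = 1.
Proof.
rewrite -{1}(residue_reprK a) -(rmorph0 residue_pi) => /eqP ha.
have {}ha : residue_repr a \notin m.
  by apply/negP => h; apply: ha; apply/residue_piP; rewrite subr0.
pose r := residue_repr a.
pose J : {pred R} := [pred y | `[< exists b, y - b * r \in m >]].
have JP y : reflect (exists b, y - b * r \in m) (y \in J) by exact: asboolP.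
have [J1|J1] := boolP (1 \in J).
  have /JP [b /residue_piP hb] := J1.
  by exists (residue_pi b); rewrite -{1}(residue_reprK a) -rmorphM /= -/r -hb rmorph1.
have m0 : 0 \in m by case: (max_ideal m).
have mP x u v : u \in m -> v \in m -> x * u + v \in m.
  by case: (max_ideal m) => _ _ + hu hv; apply.
have /(max_maximal (m := m)) hJ : idealr_closed J.
  split=> //; first by apply/JP; exists 0; rewrite mul0r subr0.
  move=> x u v /JP [b hb] /JP [c hc]; apply/JP; exists (x * b + c).
  by rewrite mulrDl opprD addrACA -mulrA -mulrBr mP.
case/negP: ha; apply: hJ.
  by move=> x hx; apply/JP; exists 0; rewrite mul0r subr0.
by apply/JP; exists 1; rewrite mul1r subrr.
Qed.

Definition residue_inv (a : residue) : residue :=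
  if a == 0 then 0 else xget 0 [set b : residue | b * a = 1].

Fact residue_mulVf a : a != 0 -> residue_inv a * a = 1.
Proof.
move=> a0; rewrite /residue_inv (negPf a0).
exact: (xgetPex 0 (residue_invP a0)).
Qed.

Fact residue_inv0 : residue_inv 0 = 0.
Proof. by rewrite /residue_inv eqxx. Qed.

HB.instance Definition _ :=
  GRing.ComNzRing_isField.Build residue residue_mulVf residue_inv0.

End Residue.

(* The map [R/m -> R/n] induced by [f : R -> R]; it is only meaningful when
   [f] is a ring morphism with [f m] included in [n]. *)
Definition residue_map (R : comNzRingType) (f : R -> R) (m n : maxSpec R)
  (a : residue m) : residue n := residue_pi n (f (residue_repr a)).

Section AutMax.
Variables (R : comNzRingType) (sigma : ringAut R).

Section Image.
Variable m : maxSpec R.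

Definition aut_pred : {pred R} := [pred x | aut_inv sigma x \in m].

Fact aut_pred_ideal : idealr_closed aut_pred.
Proof.
have [h0 h1 hD] := max_ideal m; split; rewrite ?inE ?rmorph0 ?rmorph1 //.
by move=> a u v; rewrite !inE rmorphD rmorphM; apply: hD.
Qed.

Fact aut_pred_max (J : {pred R}) : idealr_closed J ->
  {subset aut_pred <= J} -> {subset J <= aut_pred}.
Proof.
move=> [J0 J1 JD] mJ x xJ; rewrite inE.
apply: (@max_maximal _ m [pred y | sigma y \in J]).
- split; rewrite ?inE ?rmorph0 ?rmorph1 //.
  by move=> a u v; rewrite !inE rmorphD rmorphM; apply: JD.
- by move=> y ym; rewrite inE; apply: mJ; rewrite inE aut_funK.
- by rewrite inE aut_invK.
Qed.

(* The image [sigma(m)]: x is in it iff [sigma^-1 x] is in m. *)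
Definition aut_max : maxSpec R := MaxSpec aut_pred_ideal aut_pred_max.

End Image.

Definition aut_orbit (m : maxSpec R) : set (maxSpec R) :=
  [set n | exists k, n = iter k aut_max m \/ m = iter k aut_max n].

Fact iter_aut_maxE k m x :
  (x \in iter k aut_max m) = (iter k (aut_inv sigma) x \in m).
Proof. by elim: k x => // k IH x; rewrite iterS inE IH iterSr. Qed.

Fact iter_aut_invK k : cancel (iter k sigma) (iter k (aut_inv sigma)).
Proof. by elim: k => // k IH x; rewrite iterSr iterS aut_funK IH. Qed.

Fact iter_aut_inv_id p : iter p sigma =1 id -> iter p (aut_inv sigma) =1 id.
Proof. by move=> hp x; rewrite -{1}(hp x) iter_aut_invK. Qed.

End AutMax.

(* [B^t_omega]. *)
Definition brk (R : comNzRingType) (omega : set (maxSpec R)) (t : R) :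
  set (maxSpec R) := [set m | omega m /\ t \in m].

(* [A(t)] is the quotient of the ring expressions in the elements of [R] and two
   letters by the congruence [gwa_rel] generated by the axioms of rings, the
   ring structure of [R], and the four defining relations [GXr], [GYr], [GYX]
   and [GXY]. *)
Inductive gwa_expr (R : Type) : Type :=
| GCst of R
| GX
| GY
| GOpp of gwa_expr R
| GAdd of gwa_expr R & gwa_expr R
| GMul of gwa_expr R & gwa_expr R.

Arguments GX {R}.
Arguments GY {R}.

HB.instance Definition _ (R : Type) := gen_eqMixin (gwa_expr R).
HB.instance Definition _ (R : Type) := gen_choiceMixin (gwa_expr R).

Section GWA.
Variables (R : comNzRingType) (sigma : ringAut R) (t : R).
Implicit Types a b c : gwa_expr R.

Inductive gwa_rel : gwa_expr R -> gwa_expr R -> Prop :=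
| GRefl a : gwa_rel a a
| GSym a b : gwa_rel a b -> gwa_rel b a
| GTrans a b c : gwa_rel a b -> gwa_rel b c -> gwa_rel a c
| GOppC a a' : gwa_rel a a' -> gwa_rel (GOpp a) (GOpp a')
| GAddC a a' b b' :
    gwa_rel a a' -> gwa_rel b b' -> gwa_rel (GAdd a b) (GAdd a' b')
| GMulC a a' b b' :
    gwa_rel a a' -> gwa_rel b b' -> gwa_rel (GMul a b) (GMul a' b')
| Gaddr_assoc a b c : gwa_rel (GAdd a (GAdd b c)) (GAdd (GAdd a b) c)
| Gaddr_comm a b : gwa_rel (GAdd a b) (GAdd b a)
| Gadd0r a : gwa_rel (GAdd (GCst 0) a) a
| GaddNr a : gwa_rel (GAdd (GOpp a) a) (GCst 0)
| Gmulr_assoc a b c : gwa_rel (GMul a (GMul b c)) (GMul (GMul a b) c)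
| Gmul1r a : gwa_rel (GMul (GCst 1) a) a
| Gmulr1 a : gwa_rel (GMul a (GCst 1)) a
| GmulrDl a b c : gwa_rel (GMul (GAdd a b) c) (GAdd (GMul a c) (GMul b c))
| GmulrDr a b c : gwa_rel (GMul a (GAdd b c)) (GAdd (GMul a b) (GMul a c))
| GCstD r s : gwa_rel (GCst (r + s)) (GAdd (GCst r) (GCst s))
| GCstM r s : gwa_rel (GCst (r * s)) (GMul (GCst r) (GCst s))
| GXr r : gwa_rel (GMul GX (GCst r)) (GMul (GCst (sigma r)) GX)
| GYr r : gwa_rel (GMul GY (GCst r)) (GMul (GCst (aut_inv sigma r)) GY)
| GYX : gwa_rel (GMul GY GX) (GCst t)
| GXY : gwa_rel (GMul GX GY) (GCst (sigma t)).

Definition gwa_relb a b := `[< gwa_rel a b >].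

Fact gwa_relP a b : reflect (gwa_rel a b) (gwa_relb a b).
Proof. exact: asboolP. Qed.

Fact gwa_relb_equiv : equiv_class_of gwa_relb.
Proof.
split=> [a|a b|b a c /gwa_relP hab /gwa_relP hbc].
- exact/gwa_relP/GRefl.
- by apply/gwa_relP/gwa_relP => /GSym.
- exact/gwa_relP/(GTrans hab).
Qed.

Canonical gwa_equiv := EquivRelPack gwa_relb_equiv.
Canonical gwa_equiv_direct := defaultEncModRel gwa_relb.

Definition gwa : Type := {eq_quot gwa_relb}.

HB.instance Definition _ := Choice.on gwa.
HB.instance Definition _ := Quotient.on gwa.
HB.instance Definition _ : EqQuotient _ gwa_relb gwa := EqQuotient.on gwa.

Definition gwa_cls a : gwa := \pi_gwa a.

Fact gwa_clsK (x : gwa) : gwa_cls (repr x) = x.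
Proof. exact: reprK. Qed.

Fact gwa_clsP a b : gwa_cls a = gwa_cls b <-> gwa_rel a b.
Proof.
split=> [/eqP|h]; first by rewrite eqmodE => /gwa_relP.
by apply/eqP; rewrite eqmodE; apply/gwa_relP.
Qed.

Fact gwa_repr_cls a : gwa_rel (repr (gwa_cls a)) a.
Proof. by apply/gwa_clsP; rewrite gwa_clsK. Qed.

Definition gwa_zero := gwa_cls (GCst 0).
Definition gwa_one := gwa_cls (GCst 1).
Definition gwa_opp (x : gwa) := gwa_cls (GOpp (repr x)).
Definition gwa_add (x y : gwa) := gwa_cls (GAdd (repr x) (repr y)).
Definition gwa_mul (x y : gwa) := gwa_cls (GMul (repr x) (repr y)).

Fact gwa_oppE a : gwa_opp (gwa_cls a) = gwa_cls (GOpp a).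
Proof. exact/gwa_clsP/GOppC/gwa_repr_cls. Qed.
Fact gwa_addE a b : gwa_add (gwa_cls a) (gwa_cls b) = gwa_cls (GAdd a b).
Proof. by apply/gwa_clsP/GAddC; apply: gwa_repr_cls. Qed.
Fact gwa_mulE a b : gwa_mul (gwa_cls a) (gwa_cls b) = gwa_cls (GMul a b).
Proof. by apply/gwa_clsP/GMulC; apply: gwa_repr_cls. Qed.

Fact gwa_addA : associative gwa_add.
Proof.
move=> x y z; rewrite -(gwa_clsK x) -(gwa_clsK y) -(gwa_clsK z) !gwa_addE.
exact/gwa_clsP/Gaddr_assoc.
Qed.
Fact gwa_addC : commutative gwa_add.
Proof.
move=> x y; rewrite -(gwa_clsK x) -(gwa_clsK y) !gwa_addE.
exact/gwa_clsP/Gaddr_comm.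
Qed.
Fact gwa_add0 : left_id gwa_zero gwa_add.
Proof. move=> x; rewrite -(gwa_clsK x) gwa_addE; exact/gwa_clsP/Gadd0r. Qed.
Fact gwa_addN : left_inverse gwa_zero gwa_opp gwa_add.
Proof.
move=> x; rewrite -(gwa_clsK x) gwa_oppE gwa_addE; exact/gwa_clsP/GaddNr.
Qed.

HB.instance Definition _ :=
  GRing.isZmodule.Build gwa gwa_addA gwa_addC gwa_add0 gwa_addN.

Fact gwa_mulA : associative gwa_mul.
Proof.
move=> x y z; rewrite -(gwa_clsK x) -(gwa_clsK y) -(gwa_clsK z) !gwa_mulE.
exact/gwa_clsP/Gmulr_assoc.
Qed.
Fact gwa_mul1l : left_id gwa_one gwa_mul.
Proof. move=> x; rewrite -(gwa_clsK x) gwa_mulE; exact/gwa_clsP/Gmul1r. Qed.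
Fact gwa_mul1r : right_id gwa_one gwa_mul.
Proof. move=> x; rewrite -(gwa_clsK x) gwa_mulE; exact/gwa_clsP/Gmulr1. Qed.
Fact gwa_mulDl : left_distributive gwa_mul gwa_add.
Proof.
move=> x y z; rewrite -(gwa_clsK x) -(gwa_clsK y) -(gwa_clsK z).
by rewrite !(gwa_mulE, gwa_addE); exact/gwa_clsP/GmulrDl.
Qed.
Fact gwa_mulDr : right_distributive gwa_mul gwa_add.
Proof.
move=> x y z; rewrite -(gwa_clsK x) -(gwa_clsK y) -(gwa_clsK z).
by rewrite !(gwa_mulE, gwa_addE); exact/gwa_clsP/GmulrDr.
Qed.

HB.instance Definition _ := GRing.Zmodule_isPzRing.Build gwa
  gwa_mulA gwa_mul1l gwa_mul1r gwa_mulDl gwa_mulDr.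

Definition gwaC (r : R) : gwa := gwa_cls (GCst r).
Definition gwaX : gwa := gwa_cls GX.
Definition gwaY : gwa := gwa_cls GY.

Fact gwaC_nmod : nmod_morphism gwaC.
Proof.
by split=> // r s; rewrite [RHS]gwa_addE; apply/gwa_clsP/GCstD.
Qed.

Fact gwaC_monoid : monoid_morphism gwaC.
Proof.
by split=> // r s; rewrite [RHS]gwa_mulE; apply/gwa_clsP/GCstM.
Qed.

HB.instance Definition _ := GRing.isNmodMorphism.Build R gwa gwaC gwaC_nmod.
HB.instance Definition _ :=
  GRing.isMonoidMorphism.Build R gwa gwaC gwaC_monoid.

Fact gwaXC r : gwaX * gwaC r = gwaC (sigma r) * gwaX.
Proof. rewrite [LHS]gwa_mulE [RHS]gwa_mulE; exact/gwa_clsP/GXr. Qed.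
Fact gwaYC r : gwaY * gwaC r = gwaC (aut_inv sigma r) * gwaY.
Proof. rewrite [LHS]gwa_mulE [RHS]gwa_mulE; exact/gwa_clsP/GYr. Qed.
Fact gwaYX : gwaY * gwaX = gwaC t.
Proof. rewrite [LHS]gwa_mulE; exact/gwa_clsP/GYX. Qed.
Fact gwaXY : gwaX * gwaY = gwaC (sigma t).
Proof. rewrite [LHS]gwa_mulE; exact/gwa_clsP/GXY. Qed.

(* An [A(t)]-module from an action of [R] and two operators satisfying the
   relations. *)
Record gwa_data (V : zmodType) := GwaData {
  gd_act : R -> V -> V;
  gd_X : V -> V;
  gd_Y : V -> V;
  gd_actA : forall r s v, gd_act r (gd_act s v) = gd_act (r * s) v;
  gd_act1 : forall v, gd_act 1 v = v;
  gd_actDr : forall r u v, gd_act r (u + v) = gd_act r u + gd_act r v;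
  gd_actDl : forall v r s, gd_act (r + s) v = gd_act r v + gd_act s v;
  gd_XD : forall u v, gd_X (u + v) = gd_X u + gd_X v;
  gd_YD : forall u v, gd_Y (u + v) = gd_Y u + gd_Y v;
  gd_Xact : forall r v, gd_X (gd_act r v) = gd_act (sigma r) (gd_X v);
  gd_Yact : forall r v, gd_Y (gd_act r v) = gd_act (aut_inv sigma r) (gd_Y v);
  gd_YX : forall v, gd_Y (gd_X v) = gd_act t v;
  gd_XY : forall v, gd_X (gd_Y v) = gd_act (sigma t) v
}.

Section Action.
Variables (V : zmodType) (D : gwa_data V).
Implicit Types u v : V.

Fixpoint gwa_eval a v : V :=
  match a with
  | GCst r => gd_act D r v
  | GX => gd_X D v
  | GY => gd_Y D v
  | GOpp a => - gwa_eval a v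
  | GAdd a b => gwa_eval a v + gwa_eval b v
  | GMul a b => gwa_eval a (gwa_eval b v)
  end.

Fact gwa_evalD a u v : gwa_eval a (u + v) = gwa_eval a u + gwa_eval a v.
Proof.
elim: a u v => [r|||a IH|a IHa b IHb|a IHa b IHb] u v /=.
- exact: gd_actDr.
- exact: gd_XD.
- exact: gd_YD.
- by rewrite IH opprD.
- by rewrite IHa IHb addrACA.
- by rewrite IHb IHa.
Qed.

Fact gwa_eval_act0 v : gd_act D 0 v = 0.
Proof. by apply: (addIr (gd_act D 0 v)); rewrite -gd_actDl !add0r. Qed.

Fact gwa_eval_rel a b : gwa_rel a b -> forall v, gwa_eval a v = gwa_eval b v.
Proof.
elim=> {a b} //=.
- by move=> a b c _ IHa _ IHb v; rewrite IHa IHb.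
- by move=> a a' _ IH v; rewrite IH.
- by move=> a a' b b' _ IHa _ IHb v; rewrite IHa IHb.
- by move=> a a' b b' _ IHa _ IHb v; rewrite IHa IHb.
- by move=> a b c v; rewrite addrA.
- by move=> a b v; rewrite addrC.
- by move=> a v; rewrite gwa_eval_act0 add0r.
- by move=> a v; rewrite gwa_eval_act0 addNr.
- by move=> a v; rewrite gd_act1.
- by move=> a v; rewrite gd_act1.
- by move=> a b c v; rewrite gwa_evalD.
- by move=> r s v; rewrite gd_actDl.
- by move=> r s v; rewrite gd_actA.
- exact: gd_Xact.
- exact: gd_Yact.
- exact: gd_YX.
- exact: gd_XY.
Qed.

Definition gwa_act (x : gwa) v : V := gwa_eval (repr x) v.

Fact gwa_actE a v : gwa_act (gwa_cls a) v = gwa_eval a v.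
Proof. exact/gwa_eval_rel/gwa_repr_cls. Qed.

Fact gwa_actA x y v : gwa_act x (gwa_act y v) = gwa_act (x * y) v.
Proof. by rewrite -(gwa_clsK x) -(gwa_clsK y) [_ * _]gwa_mulE !gwa_actE. Qed.

Fact gwa_act1 : left_id 1 gwa_act.
Proof. by move=> v; rewrite gwa_actE /= gd_act1. Qed.

Fact gwa_actDr : right_distributive gwa_act +%R.
Proof. by move=> x u v; apply: gwa_evalD. Qed.

Fact gwa_actDl v : {morph gwa_act^~ v : x y / x + y}.
Proof.
by move=> x y; rewrite -(gwa_clsK x) -(gwa_clsK y) [_ + _]gwa_addE !gwa_actE.
Qed.

End Action.

(* An [A(t)]-module seen as an [R]-module along [R -> A(t)]. *)
Definition gwa_res (M : lmodType gwa) : Type := M.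

Section Restriction.
Variable M : lmodType gwa.

HB.instance Definition _ := GRing.Zmodule.on (gwa_res M).

Definition gwa_res_scale (r : R) (v : gwa_res M) : gwa_res M :=
  gwaC r *: (v : M).

Fact gwa_res_scaleA r s v :
  gwa_res_scale r (gwa_res_scale s v) = gwa_res_scale (r * s) v.
Proof. by rewrite /gwa_res_scale scalerA rmorphM. Qed.
Fact gwa_res_scale1 : left_id 1 gwa_res_scale.
Proof. by move=> v; rewrite /gwa_res_scale rmorph1 scale1r. Qed.
Fact gwa_res_scaleDr : right_distributive gwa_res_scale +%R.
Proof. by move=> r u v; apply: scalerDr. Qed.
Fact gwa_res_scaleDl v : {morph gwa_res_scale^~ v : r s / r + s}.
Proof. by move=> r s; rewrite /gwa_res_scale rmorphD scalerDl. Qed.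

HB.instance Definition _ := GRing.Zmodule_isLmodule.Build R (gwa_res M)
  gwa_res_scaleA gwa_res_scale1 gwa_res_scaleDr gwa_res_scaleDl.

End Restriction.

End GWA.

Section Tensor.
Variables (R : comNzRingType) (M N : lmodType R).

Local Notation free := {freeg (M * N)%type / int}.
Local Notation gen m n := (<< (m, n) >> : free).

(* The tensor product is the free abelian group on [M * N] modulo the subgroup
   generated by the bilinearity and [R]-balance relations. *)
Definition tensor_gen (x : free) : Prop :=
  [\/ exists m m' n, x = gen (m + m') n - gen m n - gen m' n,
      exists m n n', x = gen m (n + n') - gen m n - gen m n' |
      exists r m n, x = gen (r *: m) n - gen m (r *: n)].

Definition tensor_ker : {pred free} := [pred x |
  `[< forall S : {pred free}, zmod_closed S ->
      (forall y, tensor_gen y -> y \in S) -> x \in S >]].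

Fact tensor_ker_closed : zmod_closed tensor_ker.
Proof.
split=> [|x y /asboolP hx /asboolP hy]; apply/asboolP => S hS hgen.
  by case: hS.
by case: (hS) => _; apply; [apply: hx | apply: hy].
Qed.

HB.instance Definition _ :=
  GRing.isZmodClosed.Build free tensor_ker tensor_ker_closed.

Definition tensor : Type := (Quotient.quot tensor_ker).

HB.instance Definition _ := GRing.Zmodule.on tensor.
HB.instance Definition _ := Quotient.on tensor.

Definition tensor_pi (x : free) : tensor := \pi_(Quotient.quot tensor_ker) x.

Fact tensor_pi_zmod : zmod_morphism tensor_pi.
Proof. exact: (@raddfB _ _ (\pi_(Quotient.quot tensor_ker))). Qed.

HB.instance Definition _ :=
  GRing.isZmodMorphism.Build free tensor tensor_pi tensor_pi_zmod.

Definition tens (m : M) (n : N) : tensor := tensor_pi (gen m n).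

Fact tensor_pi_repr (x : tensor) :
  tensor_pi (@repr _ (Quotient.quot tensor_ker) x) = x.
Proof. exact: reprK. Qed.

Fact tensor_piP x y : tensor_pi x = tensor_pi y <-> x - y \in tensor_ker.
Proof.
rewrite /tensor_pi; split=> [/eqP|h]; first by rewrite -Quotient.idealrBE.
by apply/eqP; rewrite -Quotient.idealrBE.
Qed.

Fact tensor_gen_ker x : tensor_gen x -> x \in tensor_ker.
Proof. by move=> hx; apply/asboolP => S _; apply. Qed.

Fact tensDl m m' n : tens (m + m') n = tens m n + tens m' n.
Proof.
rewrite -raddfD; apply/tensor_piP/tensor_gen_ker/Or31.
by exists m, m', n; rewrite opprD addrA.
Qed.

Fact tensDr m n n' : tens m (n + n') = tens m n + tens m n'.
Proof.
rewrite -raddfD; apply/tensor_piP/tensor_gen_ker/Or32.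
by exists m, n, n'; rewrite opprD addrA.
Qed.

Fact tensZ r m n : tens (r *: m) n = tens m (r *: n).
Proof. by apply/tensor_piP/tensor_gen_ker/Or33; exists r, m, n. Qed.

Fact tensor_ind (P : tensor -> Prop) : P 0 ->
  (forall x y, P x -> P y -> P (x + y)) -> (forall x, P x -> P (- x)) ->
  (forall m n, P (tens m n)) -> forall x, P x.
Proof.
move=> P0 PD PN Pt x; rewrite -(tensor_pi_repr x).
rewrite -[repr x]freeg_sumE raddf_sum.
elim: (dom _) => [|[m n] s IH]; first by rewrite big_nil.
rewrite big_cons; apply: (PD _ _ _ IH).
move: (coeff _ _) => z.
have -> : << z *g (m, n) >> = (gen m n) *~ z by rewrite freegU_mulz intz.
have Pn k : P (tens m n *+ k).
  by elim: k => [|k IHk]; rewrite ?mulr0n // mulrS; apply: PD.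
rewrite raddfMz; case: z => k; first exact: Pn.
by rewrite NegzE mulrNz; apply/PN/Pn.
Qed.

Section Lift.
Variables (T : zmodType) (f : M -> N -> T).

(* The additive map sending [tens m n] to [f m n], for [f] biadditive and
   [R]-balanced. *)
Definition tensor_lift (x : tensor) : T :=
  fglift (fun mn => f mn.1 mn.2 : zmodule T) (@repr _ (Quotient.quot tensor_ker) x).

Record balanced : Prop := Balanced {
  balDl : forall m m' n, f (m + m') n = f m n + f m' n;
  balDr : forall m n n', f m (n + n') = f m n + f m n';
  balZ : forall r m n, f (r *: m) n = f m (r *: n)
}.

Hypothesis fB : balanced.

Fact tensor_lift_pi x :
  tensor_lift (tensor_pi x) = fglift (fun mn => f mn.1 mn.2 : zmodule T) x.
Proof.
set g := fglift _.
have gB : zmod_morphism g := lift_is_additive _.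
have gU m n : g (gen m n) = f m n by rewrite /g liftU scale1r.
apply/eqP; rewrite -subr_eq0 /tensor_lift -gB; apply/eqP.
have /tensor_piP/asboolP := tensor_pi_repr (tensor_pi x).
move/(_ [pred y | g y == 0]) => h; apply/eqP; apply: h.
  split=> [|u v]; first by rewrite inE -(subrr 0) gB subrr.
  by rewrite !inE gB => /eqP -> /eqP ->; rewrite subrr.
case: fB => hl hr hz y [] [a [b [c ->]]]; rewrite inE !gB !gU ?hl ?hr ?hz.
- by rewrite addrAC addrK subrr.
- by rewrite addrAC addrK subrr.
- by rewrite subrr.
Qed.

Fact tensor_lift_tens m n : tensor_lift (tens m n) = f m n.
Proof. by rewrite tensor_lift_pi liftU scale1r. Qed.

Fact tensor_liftB x y :
  tensor_lift (x - y) = tensor_lift x - tensor_lift y.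
Proof.
rewrite -(tensor_pi_repr x) -(tensor_pi_repr y) -raddfB !tensor_lift_pi.
exact: (lift_is_additive (fun mn => f mn.1 mn.2 : zmodule T)).
Qed.

Fact tensor_lift0 : tensor_lift 0 = 0.
Proof. by rewrite -(subrr (0 : tensor)) tensor_liftB subrr. Qed.

Fact tensor_liftN x : tensor_lift (- x) = - tensor_lift x.
Proof. by rewrite -[- x]sub0r tensor_liftB tensor_lift0 sub0r. Qed.

Fact tensor_liftD x y :
  tensor_lift (x + y) = tensor_lift x + tensor_lift y.
Proof. by rewrite -{1}(opprK y) tensor_liftB tensor_liftN opprK. Qed.

End Lift.

Fact tensor_ext (T : zmodType) (f g : tensor -> T) :
  (forall x y, f (x + y) = f x + f y) -> (forall x y, g (x + y) = g x + g y) ->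
  (forall m n, f (tens m n) = g (tens m n)) -> forall x, f x = g x.
Proof.
move=> fD gD fg.
have f0 : f 0 = 0 by apply: (addIr (f 0)); rewrite -fD !add0r.
have g0 : g 0 = 0 by apply: (addIr (g 0)); rewrite -gD !add0r.
apply: tensor_ind => //; first by rewrite f0 g0.
- by move=> x y hx hy; rewrite fD gD hx hy.
- by move=> x hx; apply: (addIr (f x)); rewrite {2}hx -fD -gD !addNr f0 g0.
Qed.

Definition tensor_scale (r : R) : tensor -> tensor :=
  tensor_lift (fun m n => tens (r *: m) n).

Fact tensor_scale_bal r : balanced (fun m n => tens (r *: m) n).
Proof.
split=> *; first by rewrite scalerDr tensDl.
  by rewrite tensDr.
by rewrite scalerA mulrC -scalerA tensZ.
Qed.

Fact tensor_scale_tens r m n :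
  tensor_scale r (tens m n) = tens (r *: m) n.
Proof. exact: (tensor_lift_tens (tensor_scale_bal r)). Qed.

Fact tensor_scaleDr : right_distributive tensor_scale +%R.
Proof. by move=> r x y; apply: (tensor_liftD (tensor_scale_bal r)). Qed.

Fact tensor_scaleA r s x :
  tensor_scale r (tensor_scale s x) = tensor_scale (r * s) x.
Proof.
move: x; apply: tensor_ext => [x y|x y|m n]; rewrite ?tensor_scaleDr //.
by rewrite !tensor_scale_tens scalerA.
Qed.

Fact tensor_scale1 : left_id 1 tensor_scale.
Proof.
apply: tensor_ext => [x y|x y|m n]; rewrite ?tensor_scaleDr //.
by rewrite !tensor_scale_tens scale1r.
Qed.

Fact tensor_scaleDl x : {morph tensor_scale^~ x : r s / r + s}.
Proof.
move=> r s; move: x; apply: tensor_ext => [x y|x y|m n].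
- by rewrite tensor_scaleDr.
- by rewrite !tensor_scaleDr addrACA.
- by rewrite !tensor_scale_tens scalerDl tensDl.
Qed.

HB.instance Definition _ := GRing.Zmodule_isLmodule.Build R tensor
  tensor_scaleA tensor_scale1 tensor_scaleDr tensor_scaleDl.

End Tensor.

Section GwaTensor.
Variables (R : comNzRingType) (sigma : ringAut R) (t t' : R).
Variables (M : lmodType (gwa sigma t)) (M' : lmodType (gwa sigma t')).

Definition gwa_tensor : Type := tensor (gwa_res M) (gwa_res M').

HB.instance Definition _ := GRing.Zmodule.on gwa_tensor.

Local Notation T := (tensor (gwa_res M) (gwa_res M')).

Definition gwa_tens (v : M) (v' : M') : gwa_tensor :=
  tens (v : gwa_res M) (v' : gwa_res M').

Definition gwa_tensX : T -> T := tensor_lift (fun (v : gwa_res M) (v' : gwa_res M') =>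
  gwa_tens (gwaX sigma t *: (v : M)) (gwaX sigma t' *: (v' : M'))).

Definition gwa_tensY : T -> T := tensor_lift (fun (v : gwa_res M) (v' : gwa_res M') =>
  gwa_tens (gwaY sigma t *: (v : M)) (gwaY sigma t' *: (v' : M'))).

Fact gwa_tensX_bal : balanced (fun (v : gwa_res M) (v' : gwa_res M') =>
  gwa_tens (gwaX sigma t *: (v : M)) (gwaX sigma t' *: (v' : M'))).
Proof.
split=> [v w v'|v v' w'|r v v']; rewrite /gwa_tens ?scalerDr.
- exact: tensDl.
- exact: tensDr.
rewrite [X in tens X _](_ : _ = sigma r *: (gwaX sigma t *: (v : M) : gwa_res M)).
  rewrite tensZ; congr tens.
  by rewrite [LHS]scalerA -gwaXC -scalerA.
by rewrite [LHS]scalerA gwaXC -scalerA.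
Qed.

Fact gwa_tensY_bal : balanced (fun (v : gwa_res M) (v' : gwa_res M') =>
  gwa_tens (gwaY sigma t *: (v : M)) (gwaY sigma t' *: (v' : M'))).
Proof.
split=> [v w v'|v v' w'|r v v']; rewrite /gwa_tens ?scalerDr.
- exact: tensDl.
- exact: tensDr.
rewrite [X in tens X _](_ : _ =
  aut_inv sigma r *: (gwaY sigma t *: (v : M) : gwa_res M)).
  rewrite tensZ; congr tens.
  by rewrite [LHS]scalerA -gwaYC -scalerA.
by rewrite [LHS]scalerA gwaYC -scalerA.
Qed.

Fact gwa_tensXE v v' : gwa_tensX (gwa_tens v v') =
  gwa_tens (gwaX sigma t *: v) (gwaX sigma t' *: v').
Proof. exact: (tensor_lift_tens gwa_tensX_bal). Qed.

Fact gwa_tensYE v v' : gwa_tensY (gwa_tens v v') =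
  gwa_tens (gwaY sigma t *: v) (gwaY sigma t' *: v').
Proof. exact: (tensor_lift_tens gwa_tensY_bal). Qed.

Fact gwa_tensXD (x y : T) : gwa_tensX (x + y) = gwa_tensX x + gwa_tensX y.
Proof. exact: (tensor_liftD gwa_tensX_bal). Qed.

Fact gwa_tensYD (x y : T) : gwa_tensY (x + y) = gwa_tensY x + gwa_tensY y.
Proof. exact: (tensor_liftD gwa_tensY_bal). Qed.

Fact gwa_tensZl r v v' :
  r *: (gwa_tens v v' : T) = gwa_tens (gwaC sigma t r *: v) v'.
Proof. exact: tensor_scale_tens. Qed.

Fact gwa_tensZr r v v' :
  r *: (gwa_tens v v' : T) = gwa_tens v (gwaC sigma t' r *: v').
Proof. by rewrite gwa_tensZl; apply: tensZ. Qed.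

Fact gwa_tensXact r (x : T) : gwa_tensX (r *: x) = sigma r *: gwa_tensX x.
Proof.
move: x; apply: tensor_ext => [x y|x y|v v'];
  rewrite ?(scalerDr, gwa_tensXD) //.
rewrite -/(gwa_tens v v') gwa_tensZl !gwa_tensXE gwa_tensZl.
by rewrite !scalerA gwaXC.
Qed.

Fact gwa_tensYact r (x : T) :
  gwa_tensY (r *: x) = aut_inv sigma r *: gwa_tensY x.
Proof.
move: x; apply: tensor_ext => [x y|x y|v v'];
  rewrite ?(scalerDr, gwa_tensYD) //.
rewrite -/(gwa_tens v v') gwa_tensZl !gwa_tensYE gwa_tensZl.
by rewrite !scalerA gwaYC.
Qed.

Fact gwa_tensYX (x : T) : gwa_tensY (gwa_tensX x) = (t * t') *: x.
Proof.
move: x; apply: tensor_ext => [x y|x y|v v'];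
  rewrite ?(scalerDr, gwa_tensXD, gwa_tensYD) //.
rewrite -/(gwa_tens v v') gwa_tensXE gwa_tensYE !scalerA !gwaYX.
by rewrite -[RHS]scalerA gwa_tensZr gwa_tensZl.
Qed.

Fact gwa_tensXY (x : T) : gwa_tensX (gwa_tensY x) = sigma (t * t') *: x.
Proof.
move: x; apply: tensor_ext => [x y|x y|v v'];
  rewrite ?(scalerDr, gwa_tensXD, gwa_tensYD) //.
rewrite -/(gwa_tens v v') gwa_tensYE gwa_tensXE !scalerA !gwaXY.
by rewrite rmorphM -[RHS]scalerA gwa_tensZr gwa_tensZl.
Qed.

Definition gwa_tensor_data : gwa_data sigma (t * t') T :=
  GwaData (@scalerA _ _) (@scale1r _ _) (@scalerDr _ _)
    (fun v r s => scalerDl v r s)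
    gwa_tensXD gwa_tensYD gwa_tensXact gwa_tensYact gwa_tensYX gwa_tensXY.

HB.instance Definition _ :=
  GRing.Zmodule_isLmodule.Build (gwa sigma (t * t')) gwa_tensor
    (gwa_actA gwa_tensor_data) (gwa_act1 gwa_tensor_data)
    (gwa_actDr gwa_tensor_data) (gwa_actDl gwa_tensor_data).

End GwaTensor.

Section ResidueMap.
Variables (R : comNzRingType) (f : {rmorphism R -> R}) (m n : maxSpec R).
Hypothesis fmn : forall x, x \in m -> f x \in n.

Fact residue_mapE x : residue_map f n (residue_pi m x) = residue_pi n (f x).
Proof.
by apply/residue_piP; rewrite -rmorphB; apply: fmn; apply: residue_repr_pi.
Qed.

Fact residue_map_zmod : zmod_morphism (residue_map f (m := m) n).
Proof.
move=> a b; rewrite -(residue_reprK a) -(residue_reprK b) -rmorphB.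
by rewrite !residue_mapE -!rmorphB.
Qed.

Fact residue_map_monoid : monoid_morphism (residue_map f (m := m) n).
Proof.
split=> [|a b]; first by rewrite -(rmorph1 (residue_pi m)) residue_mapE !rmorph1.
rewrite -(residue_reprK a) -(residue_reprK b) -rmorphM.
by rewrite !residue_mapE -!rmorphM.
Qed.

(* [residue_map] as a ring morphism, given the inclusion [f m <= n]. *)
Definition residue_rmorph
  of (forall x, x \in m -> f x \in n) : residue m -> residue n :=
  residue_map f n.
HB.instance Definition _ := GRing.isZmodMorphism.Build (residue m) (residue n)
  (residue_rmorph fmn) residue_map_zmod.
HB.instance Definition _ := GRing.isMonoidMorphism.Build (residue m) (residue n)
  (residue_rmorph fmn) residue_map_monoid.

End ResidueMap.

Fact residue_map_comp (R : comNzRingType) (f : R -> R) (g : {rmorphism R -> R})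
  (m n q : maxSpec R) (a : residue m) :
  (forall x, x \in n -> g x \in q) ->
  residue_map g q (residue_map f n a) = residue_map (g \o f) q a.
Proof. by move=> gnq; rewrite {2}/residue_map residue_mapE. Qed.

Fact residue_map_id (R : comNzRingType) (f : R -> R) (m : maxSpec R)
  (a : residue m) : f =1 id -> residue_map f m a = a.
Proof. by move=> fid; rewrite /residue_map fid residue_reprK. Qed.

Fact eq_residue_map (R : comNzRingType) (f g : R -> R) (m n : maxSpec R)
  (a : residue m) : f =1 g -> residue_map f n a = residue_map g n a.
Proof. by move=> fg; rewrite /residue_map fg. Qed.

Section WeightModule.
Variables (R : comNzRingType) (sigma : ringAut R) (p : nat).
Hypothesis sigmap : iter p sigma =1 id.
Variables (m0 : maxSpec R) (t : R) (d : nat) (F : 'M[residue m0]_d).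
Hypothesis Funit : F \in unitmx.

Local Notation orb k := (iter k (aut_max sigma) m0).
Local Notation tau := (aut_inv sigma).

(* The index [k : 'I_p] stands for [k.+1] in [1..p]: the component [v k] is the
   column of the coordinates of [v] on [e_{k.+1,1}, ..., e_{k.+1,d}], and the
   cyclic [ordS], [ord_pred] of ['I_p] wrap around between [p] and [1]. *)
Definition wmod_space : Type :=
  {dffun forall k : 'I_p, 'cV[residue (orb k.+1)]_d}.

HB.instance Definition _ := Choice.on wmod_space.

Implicit Types u v w : wmod_space.

Definition wmod_zero : wmod_space := [ffun k : 'I_p => 0].
Definition wmod_opp v : wmod_space := [ffun k : 'I_p => - v k].
Definition wmod_add u v : wmod_space := [ffun k : 'I_p => u k + v k].

Fact wmod_addA : associative wmod_add.
Proof. by move=> u v w; apply/ffunP => k; rewrite !ffunE addrA. Qed.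
Fact wmod_addC : commutative wmod_add.
Proof. by move=> u v; apply/ffunP => k; rewrite !ffunE addrC. Qed.
Fact wmod_add0 : left_id wmod_zero wmod_add.
Proof. by move=> u; apply/ffunP => k; rewrite !ffunE add0r. Qed.
Fact wmod_addN : left_inverse wmod_zero wmod_opp wmod_add.
Proof. by move=> u; apply/ffunP => k; rewrite !ffunE addNr. Qed.

HB.instance Definition _ :=
  GRing.isZmodule.Build wmod_space wmod_addA wmod_addC wmod_add0 wmod_addN.

Fact wmodD u v k : (u + v) k = u k + v k.
Proof. exact: ffunE. Qed.

Definition wmod_act (r : R) v : wmod_space := [ffun k : 'I_p => residue_pi _ r *: v k].

(* Matrices act on columns. [residue_map sigma] applied to [F] gives [sigma(F)];
   [residue_map id] is the identification of [R/m_0] with [R/sigma^p(m_0)]. The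
   formulas on the basis are [wmod_X_e], [wmod_X_ep], [wmod_Y_e], [wmod_Y_e1]. *)
Definition wmod_X v : wmod_space := [ffun k : 'I_p =>
  let w := map_mx (residue_map sigma (orb k.+1)) (v (ord_pred k)) in
  residue_pi _ (sigma t) *:
    (if k == 0 :> nat then map_mx (residue_map sigma (orb k.+1)) F *m w
     else w)].

Definition wmod_Y v : wmod_space := [ffun k : 'I_p =>
  let w := map_mx (residue_map tau (orb k.+1)) (v (ordS k)) in
  if k.+1 == p then map_mx (residue_map id (orb k.+1)) (invmx F) *m w else w].

Fact wmod_actA r s v : wmod_act r (wmod_act s v) = wmod_act (r * s) v.
Proof. by apply/ffunP => k; rewrite !ffunE scalerA rmorphM. Qed.
Fact wmod_act1 v : wmod_act 1 v = v.
Proof. by apply/ffunP => k; rewrite !ffunE rmorph1 scale1r. Qed.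
Fact wmod_actDr r u v : wmod_act r (u + v) = wmod_act r u + wmod_act r v.
Proof. by apply/ffunP => k; rewrite !(wmodD, ffunE) scalerDr. Qed.
Fact wmod_actDl v r s : wmod_act (r + s) v = wmod_act r v + wmod_act s v.
Proof. by apply/ffunP => k; rewrite !(wmodD, ffunE) rmorphD scalerDl. Qed.

Fact val_ord_pred (k : 'I_p) : k != 0 :> nat -> (ord_pred k).+1 = k :> nat.
Proof.
case: k => -[//|k] hk _ /=.
by rewrite modnDr modn_small // (ltn_trans _ hk).
Qed.

Fact val_ord_pred0 (k : 'I_p) : k == 0 :> nat -> (ord_pred k).+1 = p.
Proof.
case: p k => [[]//|q] [[|//] /= _] _.
by rewrite modn_small.
Qed.

Fact val_ordS (k : 'I_p) : k.+1 != p -> ordS k = k.+1 :> nat.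
Proof. by move=> hk; rewrite /= modn_small // ltn_neqAle hk /=. Qed.

Fact val_ordS0 (k : 'I_p) : k.+1 == p -> ordS k = 0%N :> nat.
Proof. by move=> /eqP hk /=; rewrite hk modnn. Qed.

Fact wmod_X_homo (k : 'I_p) x :
  x \in orb (ord_pred k).+1 -> sigma x \in orb k.+1.
Proof.
rewrite !iter_aut_maxE (iterSr k) aut_funK.
have [k0|k0] := boolP (k == 0 :> nat); last by rewrite val_ord_pred.
rewrite val_ord_pred0 // (iter_aut_inv_id sigmap).
by rewrite (eqP k0).
Qed.

Fact wmod_Y_homo (k : 'I_p) x :
  x \in orb (ordS k).+1 -> tau x \in orb k.+1.
Proof.
rewrite !iter_aut_maxE -(iterSr k.+1).
have [k0|k0] := boolP (k.+1 == p); last by rewrite val_ordS.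
by rewrite val_ordS0 // (eqP k0) (iterSr p) (iter_aut_inv_id sigmap).
Qed.

Fact wmod_F_homo (k : 'I_p) x :
  k == 0 :> nat -> x \in m0 -> sigma x \in orb k.+1.
Proof. by move=> /eqP ->; rewrite iter_aut_maxE /= aut_funK. Qed.

Fact wmod_FV_homo (k : 'I_p) x : k.+1 == p -> x \in m0 -> x \in orb k.+1.
Proof. by move=> /eqP ->; rewrite iter_aut_maxE (iter_aut_inv_id sigmap). Qed.

Local Notation sigma_at k := (residue_rmorph (wmod_X_homo (k := k))).
Local Notation tau_at k := (residue_rmorph (f := tau) (wmod_Y_homo (k := k))).

Fact wmod_XE v k : wmod_X v k =
  let w := map_mx (sigma_at k) (v (ord_pred k)) in
  residue_pi _ (sigma t) *:
    (if k == 0 :> nat then map_mx (residue_map sigma (orb k.+1)) F *m w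
     else w).
Proof. exact: ffunE. Qed.

Fact wmod_YE v k : wmod_Y v k =
  let w := map_mx (tau_at k) (v (ordS k)) in
  if k.+1 == p then map_mx (residue_map id (orb k.+1)) (invmx F) *m w else w.
Proof. exact: ffunE. Qed.

Fact wmod_XD u v : wmod_X (u + v) = wmod_X u + wmod_X v.
Proof.
apply/ffunP => k; rewrite wmodD !wmod_XE /= wmodD map_mxD.
by case: ifP => _; rewrite ?mulmxDr scalerDr.
Qed.

Fact wmod_YD u v : wmod_Y (u + v) = wmod_Y u + wmod_Y v.
Proof.
apply/ffunP => k; rewrite wmodD !wmod_YE /= wmodD map_mxD.
by case: ifP => _; rewrite ?mulmxDr.
Qed.

Fact sigma_at_pi (k : 'I_p) r :
  sigma_at k (residue_pi _ r) = residue_pi _ (sigma r).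
Proof. exact: (residue_mapE (wmod_X_homo (k := k))). Qed.

Fact tau_at_pi (k : 'I_p) r :
  tau_at k (residue_pi _ r) = residue_pi _ (tau r).
Proof. exact: (residue_mapE (f := tau) (wmod_Y_homo (k := k))). Qed.

Fact wmod_Xact r v : wmod_X (wmod_act r v) = wmod_act (sigma r) (wmod_X v).
Proof.
apply/ffunP => k; rewrite [RHS]ffunE !wmod_XE /= ffunE map_mxZ /= sigma_at_pi.
by case: ifP => _; rewrite -?scalemxAr !scalerA mulrC.
Qed.

Fact wmod_Yact r v : wmod_Y (wmod_act r v) = wmod_act (tau r) (wmod_Y v).
Proof.
apply/ffunP => k; rewrite [RHS]ffunE !wmod_YE /= ffunE map_mxZ /= tau_at_pi.
by case: ifP => _; rewrite -?scalemxAr.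
Qed.

Fact tau_sigma_at v (k : 'I_p) :
  map_mx (tau_at k) (map_mx (sigma_at (ordS k)) (v (ord_pred (ordS k)))) = v k.
Proof.
apply/matrixP => i j; rewrite !mxE.
rewrite [LHS](@residue_map_comp R _ tau); last exact: wmod_Y_homo.
move: (ord_pred _) (ordSK k) => l ->.
by apply: residue_map_id => x; apply: aut_funK.
Qed.

Fact sigma_tau_at v (k : 'I_p) :
  map_mx (sigma_at k) (map_mx (tau_at (ord_pred k)) (v (ordS (ord_pred k))))
  = v k.
Proof.
apply/matrixP => i j; rewrite !mxE.
rewrite [LHS]residue_map_comp; last exact: wmod_X_homo.
move: (ordS _) (ord_predK k) => l ->.
by apply: residue_map_id => x; apply: aut_invK.
Qed.

Fact wmod_YX v : wmod_Y (wmod_X v) = wmod_act t v.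
Proof.
apply/ffunP => k; rewrite [RHS]ffunE wmod_YE wmod_XE /=.
rewrite map_mxZ /= tau_at_pi aut_funK.
have [hk|hk] := boolP (k.+1 == p); last first.
  by rewrite (negPf (_ : ordS k != 0 :> nat)) ?val_ordS // tau_sigma_at.
rewrite (_ : (_ == _) = true); last exact/eqP/val_ordS0.
rewrite -scalemxAr map_mxM mulmxA tau_sigma_at; congr (_ *: _).
pose idr := residue_rmorph (f := idfun) (fun x => @wmod_FV_homo k x hk).
rewrite -[map_mx (residue_map id _) _]/(map_mx idr (invmx F)).
rewrite (_ : map_mx (tau_at k) _ = map_mx idr F).
  by rewrite -map_mxM mulVmx // map_mx1 mul1mx.
apply/matrixP => i j; rewrite !mxE.
rewrite [LHS](@residue_map_comp R _ tau); last exact: wmod_Y_homo.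
by apply: eq_residue_map => x; apply: aut_funK.
Qed.

Fact wmod_XY v : wmod_X (wmod_Y v) = wmod_act (sigma t) v.
Proof.
apply/ffunP => k; rewrite [RHS]ffunE wmod_XE wmod_YE /=; congr (_ *: _).
have [hk|hk] := boolP (k == 0 :> nat); last first.
  rewrite (negPf (_ : (ord_pred k).+1 != p)) ?sigma_tau_at //.
  by rewrite val_ord_pred // neq_ltn ltn_ord.
rewrite (_ : (_ == _) = true); last exact/eqP/val_ord_pred0.
rewrite map_mxM mulmxA sigma_tau_at.
pose sr := residue_rmorph (fun x => @wmod_F_homo k x hk).
rewrite -[map_mx (residue_map sigma _) F]/(map_mx sr F).
rewrite (_ : map_mx (sigma_at k) _ = map_mx sr (invmx F)).
  by rewrite -map_mxM mulmxV // map_mx1 mul1mx.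
apply/matrixP => i j; rewrite !mxE.
by rewrite [LHS]residue_map_comp; last exact: wmod_X_homo.
Qed.

Definition wmod_data : gwa_data sigma t wmod_space :=
  GwaData wmod_actA wmod_act1 wmod_actDr wmod_actDl wmod_XD wmod_YD
    wmod_Xact wmod_Yact wmod_YX wmod_XY.

End WeightModule.

(* [V^t(omega, 1^p, F)], with omega the orbit of [m0]. The parameters unused in
   the carrier determine the [A(t)]-module structure. *)
Definition wmod (R : comNzRingType) (sigma : ringAut R) (p : nat)
  (sigmap : iter p sigma =1 id) (m0 : maxSpec R) (t : R) (d : nat)
  (F : 'M[residue m0]_d) (Funit : F \in unitmx) : Type :=
  wmod_space sigma p m0 d.

Section WmodModule.
Variables (R : comNzRingType) (sigma : ringAut R) (p : nat).
Variables (sigmap : iter p sigma =1 id) (m0 : maxSpec R) (t : R) (d : nat).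
Variables (F : 'M[residue m0]_d) (Funit : F \in unitmx).

Local Notation V := (wmod sigmap t Funit).
Local Notation D := (wmod_data sigmap t Funit).

HB.instance Definition _ := GRing.Zmodule.on V.
HB.instance Definition _ := GRing.Zmodule_isLmodule.Build (gwa sigma t) V
  (gwa_actA D) (gwa_act1 D) (gwa_actDr D) (gwa_actDl D).

End WmodModule.

Fact tensmx_unitmx (K : fieldType) (d d' : nat) (F : 'M[K]_d) (G : 'M[K]_d') :
  F \in unitmx -> G \in unitmx -> tensmx F G \in unitmx.
Proof.
move=> hF hG; suff /mulmx1_unit [] : tensmx F G *m tensmx (invmx F) (invmx G) = 1%:M by [].
rewrite tensmx_mul !mulmxV //; apply/matrixP => i j; rewrite !mxE -natrM mulnb.
rewrite -(inj_eq (can_inj (@mxtens_unindexK d d'))) -pair_eqE.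
by case: (mxtens_unindex i) => a b; case: (mxtens_unindex j).
Qed.

Section WmodBasis.
Variables (R : comNzRingType) (sigma : ringAut R) (p : nat).
Variables (sigmap : iter p sigma =1 id) (m0 : maxSpec R) (t : R) (d : nat).
Variables (F : 'M[residue m0]_d) (Funit : F \in unitmx).

Local Notation V := (wmod sigmap t Funit).
Local Notation C := (gwaC sigma t).
Local Notation X := (gwaX sigma t).
Local Notation Y := (gwaY sigma t).

(* The vector [e_{k.+1,s}]. *)
Definition wmod_e (k : 'I_p) (s : 'I_d) : V :=
  [ffun l : 'I_p => if l == k then delta_mx s 0 else 0].

Fact wmod_CE r (v : V) : C r *: v = wmod_act r v.
Proof. exact: (gwa_actE (wmod_data sigmap t Funit)). Qed.

Fact wmod_gXE (v : V) : X *: v = wmod_X t F v.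
Proof. exact: (gwa_actE (wmod_data sigmap t Funit)). Qed.

Fact wmod_gYE (v : V) : Y *: v = wmod_Y F v.
Proof. exact: (gwa_actE (wmod_data sigmap t Funit)). Qed.

Fact wmod_coordD (u v : V) k : (u + v) k = u k + v k.
Proof. exact: wmodD. Qed.

Fact wmod_coord_sum (I : Type) (s : seq I) (f : I -> V) k :
  (\sum_(i <- s) f i) k = \sum_(i <- s) f i k.
Proof.
by apply: (big_morph (fun v : V => v k) (fun u v => wmod_coordD u v k));
  apply: ffunE.
Qed.

Fact wmod_X_e (k : 'I_p) (s : 'I_d) : k.+1 != p ->
  X *: wmod_e k s = C (sigma t) *: wmod_e (ordS k) s.
Proof.
move=> hk; rewrite wmod_gXE wmod_CE; apply/ffunP => l.
rewrite (wmod_XE sigmap) [RHS]ffunE; lazy zeta; congr (_ *: _); rewrite !ffunE.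
rewrite -(inj_eq (@ordS_inj p)) ord_predK; case: (l =P _) => [e|_].
  by rewrite map_delta_mx ifF // e val_ordS.
by rewrite map_mx0; case: ifP => _; rewrite ?mulmx0.
Qed.

Fact wmod_X_ep (k : 'I_p) (s : 'I_d) : k.+1 = p ->
  X *: wmod_e k s = C (sigma t) *:
    \sum_s' C (sigma (residue_repr (F s' s))) *: wmod_e (ordS k) s'.
Proof.
move=> /eqP hk; rewrite wmod_gXE wmod_CE; apply/ffunP => l.
rewrite (wmod_XE sigmap) [RHS]ffunE wmod_coord_sum; lazy zeta; congr (_ *: _).
under eq_bigr do rewrite wmod_CE 2!ffunE.
rewrite !ffunE -(inj_eq (@ordS_inj p)) ord_predK; case: (l =P _) => [e|_].
  rewrite map_delta_mx ifT; last by rewrite e; apply/eqP/val_ordS0.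
  rewrite -colE; apply/matrixP => i j; rewrite !mxE summxE (bigD1 i) //= big1.
    by rewrite !mxE ord1 !eqxx mulr1 addr0.
  by move=> s' hs; rewrite !mxE eq_sym (negPf hs) mulr0.
rewrite map_mx0 big1 => [|s' _]; last by rewrite scaler0.
by case: ifP => _; rewrite ?mulmx0.
Qed.

Fact wmod_Y_e (k : 'I_p) (s : 'I_d) : k != 0 :> nat -> Y *: wmod_e k s = wmod_e (ord_pred k) s.
Proof.
move=> hk; rewrite wmod_gYE; apply/ffunP => l.
rewrite (wmod_YE sigmap); lazy zeta; rewrite !ffunE.
rewrite -(inj_eq (@ord_pred_inj p)) ordSK; case: (l =P _) => [e|_].
  by rewrite map_delta_mx ifF // e val_ord_pred // ltn_eqF.
by rewrite map_mx0; case: ifP => _; rewrite ?mulmx0.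
Qed.

Fact wmod_Y_e1 (k : 'I_p) (s : 'I_d) : k = 0 :> nat ->
  Y *: wmod_e k s =
    \sum_s' C (residue_repr (invmx F s' s)) *: wmod_e (ord_pred k) s'.
Proof.
move=> /eqP hk; rewrite wmod_gYE; apply/ffunP => l.
rewrite (wmod_YE sigmap) wmod_coord_sum; lazy zeta.
under eq_bigr do rewrite wmod_CE 2!ffunE.
rewrite !ffunE -(inj_eq (@ord_pred_inj p)) ordSK; case: (l =P _) => [e|_].
  rewrite map_delta_mx ifT; last by rewrite e; apply/eqP/val_ord_pred0.
  rewrite -colE; apply/matrixP => i j; rewrite !mxE summxE (bigD1 i) //= big1.
    by rewrite !mxE ord1 !eqxx mulr1 addr0.
  by move=> s' hs; rewrite !mxE eq_sym (negPf hs) mulr0.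
rewrite map_mx0 big1 => [|s' _]; last by rewrite scaler0.
by case: ifP => _; rewrite ?mulmx0.
Qed.

End WmodBasis.

(* Main.v *)
(* Sending [v (x) v'] to the family of componentwise Kronecker products
   [v_k (x) v'_k] is compatible with [X] and [Y] by the mixed product rule and
   [(F (x) G)^-1 = F^-1 (x) G^-1]. It is bijective because [e_{k,s} (x) e_{l,s'}]
   vanishes for [k <> l]: it is killed by two distinct, hence comaximal, maximal
   ideals. The remaining [e_{k,s} (x) e_{k,s'}] map to the basis of the target. *)
From HB Require Import structures.
Require Import Defs.
From mathcomp Require Import all_boot all_order all_algebra.
From mathcomp Require Import boolp classical_sets functions cardinality.
From mathcomp Require Import mxtens.

Set Implicit Arguments.
Unset Strict Implicit.
Unset Printing Implicit Defensive.

Import GRing.Theory.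
Local Open Scope classical_set_scope.
Local Open Scope card_scope.
Local Open Scope ring_scope.

(** Every element of [gwa] is the class of an expression in constants of [R], [X] and [Y], so
    compatibility with these generators spreads to all scalars by induction on a representative. *)
Lemma gwa_linear (R : comNzRingType) (sigma : ringAut R) (t : R)
  (M N : lmodType (gwa sigma t)) (f : M -> N) :
  {morph f : u v / u + v} ->
  (forall r v, f (gwaC sigma t r *: v) = gwaC sigma t r *: f v) ->
  (forall v, f (gwaX sigma t *: v) = gwaX sigma t *: f v) ->
  (forall v, f (gwaY sigma t *: v) = gwaY sigma t *: f v) ->
  linear f.
Proof.
move=> fD fC fX fY x u v; rewrite fD; congr (_ + _).
have f0 : f 0 = 0 by apply: (addIr (f 0)); rewrite -fD !add0r.
have fN w : f (- w) = - f w by apply: (addIr (f w)); rewrite -fD !addNr f0.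
rewrite -(gwa_clsK x).
elim: (repr x) u => [r|||a IH|a IHa b IHb|a IHa b IHb] u.
- exact: fC.
- exact: fX.
- exact: fY.
- have -> : gwa_cls sigma t (GOpp a) = - gwa_cls sigma t a.
    by rewrite [RHS]gwa_oppE.
  by rewrite !scaleNr fN IH.
- have -> : gwa_cls sigma t (GAdd a b) = gwa_cls sigma t a + gwa_cls sigma t b.
    by rewrite [RHS]gwa_addE.
  by rewrite !scalerDl fD IHa IHb.
- have -> : gwa_cls sigma t (GMul a b) = gwa_cls sigma t a * gwa_cls sigma t b.
    by rewrite [RHS]gwa_mulE.
  by rewrite -!scalerA IHa IHb.
Qed.

(** * Scalars and generators acting on pure tensors *)

Section GwaTensorTheory.
Variables (R : comNzRingType) (sigma : ringAut R) (t t' : R).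
Variables (M : lmodType (gwa sigma t)) (M' : lmodType (gwa sigma t')).

Local Notation T := (gwa_tensor M M').
Local Notation C := (gwaC sigma).

Lemma gwa_tensor_ext (U : zmodType) (f g : T -> U) :
  {morph f : x y / x + y} -> {morph g : x y / x + y} ->
  (forall v v', f (gwa_tens v v') = g (gwa_tens v v')) -> f =1 g.
Proof. exact: tensor_ext. Qed.

Lemma gwa_tensor_CE r (x : T) :
  C (t * t') r *: x = r *: (x : tensor (gwa_res M) (gwa_res M')).
Proof. exact: (gwa_actE (gwa_tensor_data M M')). Qed.

Lemma gwa_tensor_XE v v' :
  gwaX sigma (t * t') *: gwa_tens v v' =
  gwa_tens (gwaX sigma t *: v) (gwaX sigma t' *: v') :> T.
Proof.
rewrite -gwa_tensXE; exact: (gwa_actE (gwa_tensor_data M M')).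
Qed.

Lemma gwa_tensor_YE v v' :
  gwaY sigma (t * t') *: gwa_tens v v' =
  gwa_tens (gwaY sigma t *: v) (gwaY sigma t' *: v') :> T.
Proof.
rewrite -gwa_tensYE; exact: (gwa_actE (gwa_tensor_data M M')).
Qed.

Lemma gwa_tens0l v' : gwa_tens 0 v' = 0 :> T.
Proof. by apply: (addIr (gwa_tens 0 v')); rewrite add0r -[LHS]tensDl addr0. Qed.

Lemma gwa_tens0r v : gwa_tens v 0 = 0 :> T.
Proof. by apply: (addIr (gwa_tens v 0)); rewrite add0r -[LHS]tensDr addr0. Qed.

Lemma gwa_tens_suml I (r : seq I) (P : pred I) (f : I -> M) (v' : M') :
  gwa_tens (\sum_(i <- r | P i) f i) v' =
  \sum_(i <- r | P i) gwa_tens (f i) v' :> T.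
Proof.
apply: (big_morph (fun v => gwa_tens v v')) => [v w|]; first exact: tensDl.
exact: gwa_tens0l.
Qed.

Lemma gwa_tens_sumr I (r : seq I) (P : pred I) (v : M) (f : I -> M') :
  gwa_tens v (\sum_(i <- r | P i) f i) =
  \sum_(i <- r | P i) gwa_tens v (f i) :> T.
Proof.
apply: (big_morph (fun v' => gwa_tens v v')) => [v' w'|]; first exact: tensDr.
exact: gwa_tens0r.
Qed.

Lemma gwa_tens_CC r r' (v : M) (v' : M') :
  gwa_tens (C t r *: v) (C t' r' *: v') =
  C (t * t') (r * r') *: gwa_tens v v' :> T.
Proof. by rewrite -gwa_tensZr -gwa_tensZl gwa_tensor_CE scalerA mulrC. Qed.

End GwaTensorTheory.

(** * Maximal ideals and counting *)

Lemma maxSpec_eq (R : comNzRingType) (m n : maxSpec R) : m =i n -> m = n.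
Proof.
case: m n => [A Ai Am] [B Bi Bm] /= AB.
have eAB : A = B by apply/funext.
move: Ai Am; rewrite {}eAB => Ai Am.
by congr MaxSpec; apply: Prop_irrelevance.
Qed.

(** The set [J] below is the sum of the two ideals. Were it proper, it would be an ideal containing
    both, so maximality would squeeze each of [m] and [n] into the other. *)
Lemma maxSpec_comax (R : comNzRingType) (m n : maxSpec R) :
  m <> n -> exists2 r, r \in m & 1 - r \in n.
Proof.
move=> mn; have [m0 _ mD] := max_ideal m; have [n0 _ nD] := max_ideal n.
pose J : {pred R} := [pred y | `[< exists2 r, r \in m & y - r \in n >]].
have JP y : reflect (exists2 r, r \in m & y - r \in n) (y \in J).
  exact: asboolP.
have [/JP //|J1] := boolP (1 \in J).
have J_ideal : idealr_closed J.
  split=> //; first by apply/JP; exists 0; rewrite ?subrr.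
  move=> a x y /JP [r rm xr] /JP [s sm ys]; apply/JP.
  exists (a * r + s); first exact: mD.
  by rewrite opprD addrACA -mulrBr; apply: nD.
have mJ : {subset m <= J} by move=> x xm; apply/JP; exists x; rewrite ?subrr.
have nJ : {subset n <= J} by move=> x xn; apply/JP; exists 0; rewrite ?subr0.
case: mn; apply: maxSpec_eq => x; apply/idP/idP => [/mJ|/nJ].
  exact: (max_maximal J_ideal nJ).
exact: (max_maximal J_ideal mJ).
Qed.

(** Following [h] by a bijection from its image to [I_p] gives a surjective self-map of a finite
    set, which is injective by counting. *)
Lemma card_image_II_inj (T : Type) (h : nat -> T) (p : nat) :
  [set h k | k in `I_p] #= `I_p -> injective (fun k : 'I_p => h k).
Proof.
move=> /card_set_bijP [g [gI _ gS]].
have gp (k : 'I_p) : (g (h k) < p)%N by apply: gI; exists (k : nat) => //=.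
pose g' (k : 'I_p) : 'I_p := Ordinal (gp k).
have g'S y : y \in codom g'.
  have [/= _ [k kp <-] e] := gS y (ltn_ord y).
  by apply/codomP; exists (Ordinal kp); apply/val_inj.
have g'inj : injective g'.
  apply/injectiveP/card_uniqP; rewrite size_codom -(eq_card (A := predT)) //.
  by move=> y; rewrite g'S.
by move=> k l hkl; apply: g'inj; apply/val_inj; rewrite /= hkl.
Qed.

(** * Kronecker products of matrices and columns *)

Lemma tensmx11 (K : pzRingType) (d d' : nat) :
  tensmx (1%:M : 'M[K]_d) (1%:M : 'M[K]_d') = 1%:M.
Proof.
apply/matrixP => i j; rewrite !mxE -natrM mulnb.
rewrite -(inj_eq (can_inj (@mxtens_unindexK d d'))) -pair_eqE.
by case: (mxtens_unindex i) => a b; case: (mxtens_unindex j).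
Qed.

Lemma invmx_tens (K : fieldType) (d d' : nat) (F : 'M[K]_d) (G : 'M[K]_d') :
  F \in unitmx -> G \in unitmx ->
  invmx (tensmx F G) = tensmx (invmx F) (invmx G).
Proof.
(* The identity is inserted on the right as $FF^{-1}\otimes GG^{-1}$; the mixed product rule then
   exposes a factor [tensmx F G] for the inverse to cancel. *)
move=> hF hG; rewrite -[LHS]mulmx1 -(tensmx11 K d d') -(mulmxV hF) -(mulmxV hG).
by rewrite -tensmx_mul mulKmx // tensmx_unitmx.
Qed.

(* [tensmx] gives two columns the width [1 * 1], on which rewriting fails. *)
Definition tens_col (K : pzRingType) (d d' : nat) (u : 'cV[K]_d)
  (v : 'cV[K]_d') : 'cV[K]_(d * d') := tensmx u v.

Lemma map_tens_col (K L : pzRingType) (f : {rmorphism K -> L}) (d d' : nat)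
  (u : 'cV[K]_d) (v : 'cV[K]_d') :
  map_mx f (tens_col u v) = tens_col (map_mx f u) (map_mx f v).
Proof. by apply/matrixP => i j; rewrite !mxE rmorphM. Qed.

Lemma mul_tens_col (K : comPzRingType) (d d' : nat) (F : 'M[K]_d)
  (G : 'M[K]_d') (u : 'cV[K]_d) (v : 'cV[K]_d') :
  tensmx F G *m tens_col u v = tens_col (F *m u) (G *m v).
Proof. exact: (tensmx_mul F G u v). Qed.

Lemma tens_colE (K : pzRingType) (d d' : nat) (u : 'cV[K]_d) (v : 'cV[K]_d') s s' :
  tens_col u v (mxtens_index (s, s')) 0 = u s 0 * v s' 0.
Proof. by rewrite !mxE mxtens_indexK !ord1. Qed.

Lemma tens_col_delta (K : pzRingType) (d d' : nat) (s : 'I_d) (s' : 'I_d') :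
  tens_col (delta_mx s 0 : 'cV[K]_d) (delta_mx s' 0) =
  delta_mx (mxtens_index (s, s')) 0.
Proof.
apply/matrixP => i j; rewrite !mxE !ord1 !eqxx !andbT -natrM mulnb.
rewrite -(inj_eq (can_inj (@mxtens_unindexK d d'))) mxtens_indexK -pair_eqE.
by case: (mxtens_unindex i).
Qed.

Section WmodTensor.
Variables (R : comNzRingType) (sigma : ringAut R) (p : nat).
Variables (sigmap : iter p sigma =1 id) (m0 : maxSpec R).

Local Notation orb k := (iter k (aut_max sigma) m0).
Local Notation tau := (aut_inv sigma).

(** * Distinct points of the orbit *)

Lemma iter_aut_max_period : orb p = m0.
Proof.
by apply: maxSpec_eq => x; rewrite iter_aut_maxE (iter_aut_inv_id sigmap).
Qed.

(** Injectivity is given for the exponents $0,\dots,p-1$, while the components of a weight module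
    lie over the exponents $1,\dots,p$. The cyclic successor [ordS] bridges the shift, with
    $\sigma^p(\mathfrak m_0)=\mathfrak m_0$ at the wrap-around. *)
Lemma orbit_comax (k l : 'I_p) :
  injective (fun i : 'I_p => orb i) -> k != l ->
  exists2 r, r \in orb k.+1 & 1 - r \in orb l.+1.
Proof.
move=> h_inj kl; apply: maxSpec_comax => kl_eq; case/eqP: kl.
suff orbS (i : 'I_p) : orb i.+1 = orb (ordS i).
  by apply: (@ordS_inj p); apply: h_inj; rewrite -!orbS.
have [ip|ip] := boolP (i.+1 == p); last by rewrite val_ordS.
by rewrite val_ordS0 // (eqP ip) iter_aut_max_period.
Qed.

(** * Coordinates in a weight module *)

Section Coordinates.
Variables (t : R) (d : nat) (F : 'M[residue m0]_d) (Funit : F \in unitmx).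

Local Notation V := (wmod sigmap t Funit).
Local Notation C := (gwaC sigma t).
Local Notation e := (wmod_e sigmap t Funit).

Lemma wmod_C_eE r (k : 'I_p) s l :
  (C r *: e k s) l = if l == k then residue_pi (orb l.+1) r *: delta_mx s 0 else 0.
Proof. by rewrite wmod_CE !ffunE; case: eqP => // _; rewrite scaler0. Qed.

(** A scalar acts on component [k] through its residue, so a chosen representative may be exchanged
    for any other. *)
Lemma wmod_C_e_eq r r' (k : 'I_p) s :
  residue_pi (orb k.+1) r = residue_pi (orb k.+1) r' ->
  C r *: e k s = C r' *: e k s.
Proof.
move=> rr; apply/ffunP => l; rewrite !wmod_C_eE; case: eqP => // ->.
by rewrite rr.
Qed.

Lemma wmod_C_e0 r (k : 'I_p) s : r \in orb k.+1 -> C r *: e k s = 0.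
Proof.
move=> rk; rewrite -[RHS](scale0r (e k s)) -(rmorph0 C).
by apply/wmod_C_e_eq/residue_piP; rewrite subr0.
Qed.

(** Coordinates are residues, but only [R] acts through [C]; hence they are lifted by
    [residue_repr], and [residue_reprK] recovers them. *)
Lemma wmod_decomp (v : V) :
  v = \sum_(k < p) \sum_(s < d) C (residue_repr (v k s 0)) *: e k s.
Proof.
apply/ffunP => l; rewrite wmod_coord_sum (bigD1 l) //= [X in _ + X]big1 => [|k kl].
  rewrite addr0 wmod_coord_sum; apply/matrixP => i j.
  rewrite ord1 summxE (bigD1 i) //= [X in _ + X]big1 => [|s si].
    by rewrite wmod_C_eE eqxx !mxE !eqxx mulr1 addr0 residue_reprK.
  by rewrite wmod_C_eE eqxx !mxE eq_sym (negPf si) mulr0.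
rewrite wmod_coord_sum big1 // => s _.
by rewrite wmod_C_eE eq_sym (negPf kl).
Qed.

End Coordinates.

(** * The map induced by componentwise Kronecker products *)

Variables (t t' : R) (d d' : nat).
Variables (F : 'M[residue m0]_d) (Funit : F \in unitmx).
Variables (G : 'M[residue m0]_d') (Gunit : G \in unitmx).

Local Notation V := (wmod sigmap t Funit).
Local Notation V' := (wmod sigmap t' Gunit).
Local Notation W := (wmod sigmap (t * t') (tensmx_unitmx Funit Gunit)).
Local Notation T := (gwa_tensor V V').
Local Notation C := (gwaC sigma).

(** Only components of equal index are paired, since they have entries in the same residue field. *)
Definition wmod_tens (v : V) (v' : V') : W :=
  [ffun k : 'I_p => tens_col (v k) (v' k)].

Lemma wmod_tensE v v' k s s' :
  wmod_tens v v' k (mxtens_index (s, s')) 0 = v k s 0 * v' k s' 0.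
Proof. by rewrite ffunE tens_colE. Qed.

Lemma wmod_tens_e k s s' :
  wmod_tens (wmod_e sigmap t Funit k s) (wmod_e sigmap t' Gunit k s') =
  wmod_e sigmap (t * t') (tensmx_unitmx Funit Gunit) k (mxtens_index (s, s')).
Proof.
apply/ffunP => l; rewrite !ffunE; case: (l == k); first exact: tens_col_delta.
by apply/matrixP => i j; rewrite !mxE mulr0.
Qed.

Lemma wmod_tensDl v w v' :
  wmod_tens (v + w) v' = wmod_tens v v' + wmod_tens w v'.
Proof.
apply/ffunP => k; rewrite !ffunE.
by apply/matrixP => i j; rewrite !mxE mulrDl.
Qed.

Lemma wmod_tensDr v v' w' :
  wmod_tens v (v' + w') = wmod_tens v v' + wmod_tens v w'.
Proof.
apply/ffunP => k; rewrite !ffunE.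
by apply/matrixP => i j; rewrite !mxE mulrDr.
Qed.

Lemma wmod_tensCl r v v' :
  wmod_tens (C t r *: v) v' = C (t * t') r *: wmod_tens v v'.
Proof.
apply/ffunP => k; rewrite !wmod_CE !ffunE.
by apply/matrixP => i j; rewrite !mxE mulrA.
Qed.

Lemma wmod_tensCr r v v' :
  wmod_tens v (C t' r *: v') = C (t * t') r *: wmod_tens v v'.
Proof.
apply/ffunP => k; rewrite !wmod_CE !ffunE.
by apply/matrixP => i j; rewrite !mxE mulrCA.
Qed.

Lemma wmod_tens_bal :
  balanced (fun (v : gwa_res V) (v' : gwa_res V') => wmod_tens v v').
Proof.
split=> [v w v'|v v' w'|r v v'].
- exact: wmod_tensDl.
- exact: wmod_tensDr.
- exact: etrans (wmod_tensCl r v v') (esym (wmod_tensCr r v v')).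
Qed.

Lemma wmod_tens_X v v' :
  wmod_tens (gwaX sigma t *: v) (gwaX sigma t' *: v') =
  gwaX sigma (t * t') *: wmod_tens v v'.
Proof.
apply/ffunP => k; rewrite ffunE !wmod_gXE !(wmod_XE sigmap).
lazy zeta; rewrite !ffunE map_tens_col.
(* The scalar $\sigma(tt')$ splits in two stages, first under $\sigma$ and then under the residue
   map. *)
rewrite [in RHS]rmorphM [in RHS]rmorphM /=.
have [k0|_] := boolP (k == 0 :> nat); last first.
  by apply/matrixP => i j; rewrite !mxE mulrACA.
(* Mapping entries commutes with [tensmx] only along a ring morphism; at [k = 0], $\sigma$ sends
   $\mathfrak m_0$ into the ideal of component [k], so [residue_map sigma] is one. *)
have FG_map := map_mxT (residue_rmorph (fun x => @wmod_F_homo R sigma p m0 k x k0)) F G.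
rewrite [map_mx _ (tensmx F G)]FG_map mul_tens_col.
by apply/matrixP => i j; rewrite [LHS]mxE [RHS]mxE !mxE mulrACA.
Qed.

Lemma wmod_tens_Y v v' :
  wmod_tens (gwaY sigma t *: v) (gwaY sigma t' *: v') =
  gwaY sigma (t * t') *: wmod_tens v v'.
Proof.
apply/ffunP => k; rewrite ffunE !wmod_gYE !(wmod_YE sigmap).
lazy zeta; rewrite !ffunE map_tens_col.
have [kp|_] := boolP (k.+1 == p) => //.
(* At the last index $\sigma^p(\mathfrak m_0)=\mathfrak m_0$ makes the residue map of the identity a
   ring morphism. *)
have FG_map := map_mxT (residue_rmorph (f := idfun)
  (fun x => @wmod_FV_homo R sigma p sigmap m0 k x kp)) (invmx F) (invmx G).
by rewrite invmx_tens // [map_mx _ (tensmx _ _)]FG_map mul_tens_col.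
Qed.

Definition wmod_lift : T -> W :=
  tensor_lift (fun (v : gwa_res V) (v' : gwa_res V') => wmod_tens v v').

Lemma wmod_lift_tens v v' : wmod_lift (gwa_tens v v') = wmod_tens v v'.
Proof. exact: (tensor_lift_tens wmod_tens_bal). Qed.

Lemma wmod_liftD : {morph wmod_lift : x y / x + y}.
Proof. exact: (tensor_liftD wmod_tens_bal). Qed.

(** It suffices to treat the generators of the algebra, and for each of them, by additivity, pure
    tensors. *)
Lemma wmod_lift_linear : linear wmod_lift.
Proof.
apply: gwa_linear => [|r|| ]; first exact: wmod_liftD.
- apply: gwa_tensor_ext => [x y|x y|v v']; rewrite ?(scalerDr, wmod_liftD) //.
  by rewrite gwa_tensor_CE gwa_tensZl !wmod_lift_tens wmod_tensCl.
- apply: gwa_tensor_ext => [x y|x y|v v']; rewrite ?(scalerDr, wmod_liftD) //.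
  by rewrite gwa_tensor_XE !wmod_lift_tens wmod_tens_X.
- apply: gwa_tensor_ext => [x y|x y|v v']; rewrite ?(scalerDr, wmod_liftD) //.
  by rewrite gwa_tensor_YE !wmod_lift_tens wmod_tens_Y.
Qed.

HB.instance Definition _ :=
  GRing.isLinear.Build _ _ _ _ wmod_lift wmod_lift_linear.

(** * The inverse map *)

Definition tens_e (k : 'I_p) (s : 'I_d) (s' : 'I_d') : T :=
  gwa_tens (wmod_e sigmap t Funit k s) (wmod_e sigmap t' Gunit k s').

Definition wmod_unlift (w : W) : T := \sum_(k < p) \sum_(s < d) \sum_(s' < d')
  C (t * t') (residue_repr (w k (mxtens_index (s, s')) 0)) *: tens_e k s s'.

Lemma tens_e_eq r r' (k : 'I_p) s s' :
  residue_pi (orb k.+1) r = residue_pi (orb k.+1) r' ->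
  C (t * t') r *: tens_e k s s' = C (t * t') r' *: tens_e k s s'.
Proof.
move=> rr; rewrite !gwa_tensor_CE !gwa_tensZl.
by congr gwa_tens; exact: wmod_C_e_eq.
Qed.

(** The lifts [residue_repr] are not additive in general, but their residues are, and [tens_e_eq]
    sees only residues. *)
Lemma wmod_unliftD : {morph wmod_unlift : u v / u + v}.
Proof.
move=> u v; rewrite /wmod_unlift -big_split; apply: eq_bigr => k _ /=.
rewrite -big_split; apply: eq_bigr => s _ /=.
rewrite -big_split; apply: eq_bigr => s' _ /=.
rewrite -scalerDl -rmorphD; apply: tens_e_eq.
by rewrite residue_reprK wmod_coordD mxE rmorphD /= !residue_reprK.
Qed.

Lemma gwa_tens_e_neq (k l : 'I_p) s s' :
  injective (fun i : 'I_p => orb i) -> k != l ->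
  gwa_tens (wmod_e sigmap t Funit k s) (wmod_e sigmap t' Gunit l s') = 0 :> T.
Proof.
move=> h_inj kl; have [r rk rl] := orbit_comax h_inj kl.
set x := gwa_tens _ _.
(* Splitting $1=r+(1-r)$ lets [r] be moved to the left factor and [1 - r] to the right one, each
   landing on a vector that it kills. *)
have x1 : x = C (t * t') r *: x + C (t * t') (1 - r) *: x.
  by rewrite -scalerDl -rmorphD addrC subrK rmorph1 scale1r.
rewrite x1 !gwa_tensor_CE gwa_tensZl gwa_tensZr.
by rewrite wmod_C_e0 // gwa_tens0l wmod_C_e0 // gwa_tens0r addr0.
Qed.

(** Additivity reduces to pure tensors. Expanding both factors in basis vectors gives a double sum
    over indices [k] and [l]; the terms with [l] distinct from [k] vanish, and the diagonal is
    [wmod_unlift]. *)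
Lemma wmod_liftK :
  injective (fun i : 'I_p => orb i) -> cancel wmod_lift wmod_unlift.
Proof.
move=> h_inj; apply: gwa_tensor_ext => [x y|//|v v'].
  by rewrite wmod_liftD wmod_unliftD.
rewrite wmod_lift_tens [in RHS](wmod_decomp v) [in RHS](wmod_decomp v').
rewrite gwa_tens_suml; apply: eq_bigr => k _.
rewrite gwa_tens_suml; apply: eq_bigr => s _.
rewrite gwa_tens_sumr (bigD1 k) //= [X in _ + X]big1 => [|l lk].
  rewrite addr0 gwa_tens_sumr; apply: eq_bigr => s' _.
  rewrite gwa_tens_CC wmod_tensE; apply: tens_e_eq.
  by rewrite residue_reprK rmorphM /= !residue_reprK.
rewrite gwa_tens_sumr big1 // => s' _.
by rewrite gwa_tens_CC gwa_tens_e_neq 1?eq_sym // scaler0.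
Qed.

Lemma wmod_unliftK : cancel wmod_unlift wmod_lift.
Proof.
move=> w; rewrite [RHS](wmod_decomp w) linear_sum.
apply: eq_bigr => k _; rewrite linear_sum.
(* The target basis is indexed by ['I_(d * d')], whereas [wmod_unlift] sums over pairs. *)
rewrite (reindex (fun ij : 'I_d * 'I_d' => mxtens_index ij)) /=; last first.
  exists (@mxtens_unindex d d') => i _.
    exact: mxtens_indexK.
  exact: mxtens_unindexK.
pose h s s' := C (t * t') (residue_repr (w k (mxtens_index (s, s')) 0)) *:
  wmod_e sigmap (t * t') (tensmx_unitmx Funit Gunit) k (mxtens_index (s, s')).
rewrite [RHS](eq_bigr (fun ij => h ij.1 ij.2)) => [|[s s'] //].
rewrite -(pair_bigA _ h).
apply: eq_bigr => s _; rewrite linear_sum; apply: eq_bigr => s' _.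
rewrite linearZ; congr (_ *: _).
exact: etrans (wmod_lift_tens _ _) (wmod_tens_e _ _ _).
Qed.

End WmodTensor.

Theorem lemma3p1 (R : comNzRingType) (sigma : ringAut R) (p : nat)
  (sigmap : iter p sigma =1 id)
  (m0 : maxSpec R) (omega : set (maxSpec R))
  (omega_orbit : omega = aut_orbit sigma m0)
  (omegaE : omega = [set iter k (aut_max sigma) m0 | k in `I_p])
  (omega_card : omega #= `I_p)
  (t t' : R) (t_reg : GRing.lreg t) (t'_reg : GRing.lreg t')
  (Bt : brk omega t = set0) (Bt' : brk omega t' = set0)
  (Btt' : brk omega (t * t') = set0)
  (d d' : nat)
  (F : 'M[residue m0]_d) (F_aut : F \in unitmx)
  (G : 'M[residue m0]_d') (G_aut : G \in unitmx) :
  exists f : {linear gwa_tensor (wmod sigmap t F_aut) (wmod sigmap t' G_aut)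
                -> wmod sigmap (t * t') (tensmx_unitmx F_aut G_aut)},
    bijective f.
Proof.
(* The set [omega] is the image of [I_p] and has [p] elements, so the listed ideals are pairwise
   distinct. *)
have orb_inj : injective (fun i : 'I_p => iter i (aut_max sigma) m0).
  apply: (card_image_II_inj (h := fun i => iter i (aut_max sigma) m0)).
  by rewrite -omegaE.
exists (@wmod_lift _ _ _ sigmap _ t t' _ _ _ F_aut _ G_aut).
exact: Bijective (wmod_liftK orb_inj) (@wmod_unliftK _ _ _ _ _ _ _ _ _ _ _ _ _).
Qed.
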